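(* Consider the two-stage stochastic linear program and the inexact regularized L-shaped algorithm described in the context, with descent parameter $\beta\in(0,1)$. Suppose: (i) $X$ is non-empty and bounded with diameter $D$, i.e. $\|x-\bar x\|\le D$ for all $x,\bar x\in X$; (ii) there are $\epsilon_1,\epsilon_2$ such that for every outer iteration $k$ and all $x\in X$, $\hat f_k(x)\in[f(x)-\epsilon_1,f(x)+\epsilon_2]$; (iii) there is $G>0$ such that $\|\hat g_k(x)\|\le G$ for every outer iteration $k$ and all $x\in X$; (iv) for all $k\ge 0$ and $0\le t\le T_k-2$, the bundle function $f_{k,t+1}:\mathbb{R}^n\to\mathbb{R}$ is convex, $G$-Lipschitz continuous, and for all $x\in\mathbb{R}^n$ $$\hat f_k(x)\ge f_{k,t+1}(x)\ge\max\{\hat f_k(x_{k,t+1})+\hat g_k(x_{k,t+1})^T(x-x_{k,t+1}),\ f_{k,t}(x_{k,t+1})+s_{k,t+1}^T(x-x_{k,t+1})\},$$ where $s_{k,t+1}=\rho_k(x_{k,0}-x_{k,t+1})$. Let $\bar\epsilon=(\beta+1)(\epsilon_1+\epsilon_2)$, assumed to lie in $(0,1)$. Suppose the algorithm uses the step-sizes $$\rho_k=\frac{\hat f_k(x_{k,0})-\epsilon_2-f^*}{D^2}>0\qquad\text{for all }k\ge0.$$ Define $$\delta^I:=\frac{4\bar\epsilon}{\beta},\qquad K^I:=\max\left\{0,\left\lceil\frac{\log\left(\frac{f(x_{0,0})-f^*}{\delta^I}\right)}{-\log\left(1-\frac\beta4\right)}\right\rceil\right\}$$ (with $K^I=0$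 if $f(x_{0,0})=f^*$). Then there exists an outer iteration $k\le K^I$ such that $f(x_{k,0})-f^*\le\delta^I$. Furthermore, the total number of inner steps (including null steps) before such a solution is found is at most $$\frac{32G^2D^2}{3(1-\beta)^2(2-\frac\beta4)\bar\epsilon^2}=\mathcal{O}\left(\frac1{\bar\epsilon^2}\right).$$
   Context: Problem. $\min_{x\in X} f(x):=c^Tx+\mathbb{E}_\xi[Q(x;\xi)]$ with $X=\{x\in\mathbb{R}^n: Ax=b,\ x\ge0\}$ and $Q(x;\xi)=\min_{y\in\mathbb{R}^l}\{q(\xi)^Ty: T(\xi)x+Wy=h(\xi),\ y\ge0\}$, where $A\in\mathbb{R}^{m\times n}$, $b\in\mathbb{R}^m$, $c\in\mathbb{R}^n$, $W\in\mathbb{R}^{r\times l}$ (not depending on $\xi$) and $(T(\xi),q(\xi),h(\xi))\in\mathbb{R}^{r\times n}\times\mathbb{R}^l\times\mathbb{R}^r$. The function $f:X\to\mathbb{R}$ is real-valued and convex, and $f^*=\min_{x\in X}f(x)$. $\|\cdot\|$ is the Euclidean norm. Estimates. For $x\in X$, $U(x;\xi)$ denotes a chosen element of $\arg\max_{u\in\mathbb{R}^r}\{u^T(h(\xi)-T(\xi)x): W^Tu\le q(\xi)\}$. Given a finite set $S_k$ of samples $\xi_i$ of $\xi$, $$\hat f_k(x)=c^Tx+\frac1{|S_k|}\sum_{i\in S_k}Q(x;\xi_i),\qquad \hat g_k(x)=c-\frac1{|S_k|}\sum_{i\in S_k}T(\xi_i)^TU(x;\xi_i)\in\partial\hat f_k(x).$$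 Algorithm (inexact regularized L-shaped algorithm). Input: $x_{0,0}\in X$, step-sizes $\rho_k>0$, $\beta\in(0,1)$. For each outer iteration $k=0,1,2,\dots$: draw a sample set $S_k$, form $\hat f_k,\hat g_k$, and set $f_{k,0}(x)=\hat f_k(x_{k,0})+\hat g_k(x_{k,0})^T(x-x_{k,0})$. For each inner iteration $t=0,1,2,\dots$: compute $x_{k,t+1}=\arg\min_{x\in X}\{f_{k,t}(x)+\frac{\rho_k}{2}\|x-x_{k,0}\|^2\}$. If $$\beta(\hat f_k(x_{k,0})-f_{k,t}(x_{k,t+1}))\le\hat f_k(x_{k,0})-\hat f_k(x_{k,t+1}),$$ then (serious step) set $T_k=t+1$, $x_{k+1,0}=x_{k,t+1}$, and go to outer iteration $k+1$. Otherwise (null step) form a new bundle function $$f_{k,t+1}(x)=\max\Big\{\max_{j\in J^g_{k,t+1}}\{\hat f_k(x_{k,j})+\hat g_k(x_{k,j})^T(x-x_{k,j})\},\ \max_{j\in J^s_{k,t+1}}\{f_{k,j-1}(x_{k,j})+s_{k,j}^T(x-x_{k,j})\}\Big\},$$ with index sets $J^g_{k,t+1}\subseteq\{0,\dots,t+1\}$, $J^s_{k,t+1}\subseteq\{1,\dots,t+1\}$ and $s_{k,j}=\rho_k(x_{k,0}-x_{k,j})$, and continue with $t+1$. ($T_k=\infty$ if the inner loop never terminates.) Counting. An inner step is one inner iteration (the computation of one point $x_{k,t+1}$). If $k$ is the first outer iteration for which $x_{k,0}$ has the required accuracy, the number of inner steps before such a solution is found is $\sum_{j<k}T_j$. *)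

(* Defs.v *)
From HB Require Import structures.
From mathcomp Require Import all_boot all_order all_algebra.
From mathcomp Require Import all_classical all_reals all_analysis.

Set Implicit Arguments.
Unset Strict Implicit.
Unset Printing Implicit Defensive.

Import Order.TTheory GRing.Theory Num.Theory.
Import numFieldNormedType.Exports.

Local Open Scope classical_set_scope.
Local Open Scope ring_scope.

Section euclidean.
Context (R : realType) (n : nat).
Implicit Types u v : 'cV[R]_n.

Definition dot u v : R := (u^T *m v) 0 0.

(* The library norm `|v| on matrices is the sup norm. *)
Definition enorm v : R := Num.sqrt (dot v v).

Definition nonneg v := forall i, 0 <= v i 0.

Definition is_argmin (D : set 'cV[R]_n) (f : 'cV[R]_n -> R) v :=
  D v /\ forall w, D w -> f v <= f w.

Definition lipschitz_enorm (G : R) (f : 'cV[R]_n -> R) :=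
  forall v w, `|f v - f w| <= G * enorm (v - w).

End euclidean.

(* Data of a two-stage stochastic linear program with fixed recourse; [Xi] is
   the type of the realizations of the random parameter. *)
Record tslp (R : realType) (Xi : Type) (m n r l : nat) := TSLP {
  lpA : 'M[R]_(m, n);
  lpb : 'cV[R]_m;
  lpc : 'cV[R]_n;
  lpW : 'M[R]_(r, l);
  lpT : Xi -> 'M[R]_(r, n);
  lpq : Xi -> 'cV[R]_l;
  lph : Xi -> 'cV[R]_r }.

Section two_stage.
Context (R : realType) (Xi : Type) (m n r l : nat) (p : tslp R Xi m n r l).
Implicit Types (x : 'cV[R]_n) (z : Xi) (S : seq Xi).

Definition feasible : set 'cV[R]_n := [set x | lpA p *m x = lpb p /\ nonneg x].

(* +oo if the second-stage problem is infeasible, -oo if it is unbounded. *)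
Definition recourse x z : \bar R :=
  ereal_inf [set (dot (lpq p z) y)%:E | y in
    [set y : 'cV[R]_l |
      lpT p z *m x + lpW p *m y = lph p z /\ nonneg y]].

Definition dual_feasible z : set 'cV[R]_r :=
  [set u | nonneg (lpq p z - (lpW p)^T *m u)].

Definition dual_argmax x z (u : 'cV[R]_r) :=
  dual_feasible z u /\
  forall v, dual_feasible z v ->
    dot v (lph p z - lpT p z *m x) <= dot u (lph p z - lpT p z *m x).

(* The samples form a sequence since a value may be drawn several times. *)
Definition sample_cost S x : \bar R :=
  ((dot (lpc p) x)%:E +
   ((size S)%:R^-1)%:E * \sum_(z <- S) recourse x z)%E.

Definition sample_subgrad (U : 'cV[R]_n -> Xi -> 'cV[R]_r) S x : 'cV[R]_n :=
  lpc p - (size S)%:R^-1 *: \sum_(z <- S) (lpT p z)^T *m U x z.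

End two_stage.

(* [fine] is harmless where the recourse is integrable, that is, where the
   expected cost is real. *)
Definition expected_cost (R : realType) d d' (Omega : measurableType d)
    (Xi : measurableType d') (P : probability Omega R) (xi : {RV P >-> Xi})
    m n r l (p : tslp R Xi m n r l) (x : 'cV[R]_n) : R :=
  dot (lpc p) x + fine (\int[P]_w recourse p x (xi w))%E.

(* All the quantities of one execution of the algorithm, as total functions of
   the counters: outer iteration first, then inner iteration. The values at
   iterations that are not carried out are irrelevant. *)
Record lshaped_data (R : realType) (Xi : Type) (n : nat) := LShapedData {
  samples : nat -> seq Xi;
  stepsize : nat -> R;
  iterate : nat -> nat -> 'cV[R]_n;
  bundle : nat -> nat -> 'cV[R]_n -> R;
  Jg : nat -> nat -> seq nat;
  Js : nat -> nat -> seq nat }.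

Section lshaped.
Context (R : realType) (Xi : Type) (m n r l : nat) (p : tslp R Xi m n r l).
Context (U : 'cV[R]_n -> Xi -> 'cV[R]_r) (beta : R) (a : lshaped_data R Xi n).
Implicit Types (k t j : nat) (x : 'cV[R]_n).

Local Notation "x_( k , t )" := (iterate a k%N t%N) (format "x_( k ,  t )").

Definition fhatE k x : \bar R := sample_cost p (samples a k) x.

Definition fhat k x : R := fine (fhatE k x).

Definition ghat k x : 'cV[R]_n := sample_subgrad p U (samples a k) x.

Definition gcut k j x : R :=
  fhat k x_(k, j) + dot (ghat k x_(k, j)) (x - x_(k, j)).

Definition aggregate k j : 'cV[R]_n := stepsize a k *: (x_(k, 0) - x_(k, j)).

(* Meant for 0 < j. *)
Definition scut k j x : R :=
  bundle a k j.-1 x_(k, j) + dot (aggregate k j) (x - x_(k, j)).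

Definition prox_objective k t x : R :=
  bundle a k t x + stepsize a k / 2 * enorm (x - x_(k, 0)) ^+ 2.

Definition serious k t : Prop :=
  beta * (fhat k x_(k, 0) - bundle a k t x_(k, t.+1)) <=
  fhat k x_(k, 0) - fhat k x_(k, t.+1).

(* T_k: one plus the index of the first serious step, +oo if there is none. *)
Definition inner_steps k : \bar R :=
  ereal_inf [set (t.+1%:R)%:E | t in [set t | serious k t]].

Definition reached k := forall j, (j < k)%N -> (inner_steps j < +oo)%E.

(* The empty maximum is -oo, but [bundle] is real-valued: at least one of the
   index sets of a bundle function that is formed is nonempty. *)
Definition lshaped_run :=
  [/\ feasible p x_(0, 0),
      forall k, reached k ->
        [/\ (0 < size (samples a k))%N, 0 < stepsize a k &
            forall x, bundle a k 0%N x = gcut k 0%N x],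
      forall k t, reached k -> (t%:R%:E < inner_steps k)%E ->
        is_argmin (feasible p) (prox_objective k t) x_(k, t.+1),
      forall k t, reached k -> (t.+1%:R%:E < inner_steps k)%E ->
        [/\ {subset Jg a k t.+1 <= iota 0 t.+2},
            {subset Js a k t.+1 <= iota 1 t.+1} &
            forall x, (bundle a k t.+1 x)%:E =
              maxe (\big[maxe/-oo%E]_(j <- Jg a k t.+1) (gcut k j x)%:E)
                   (\big[maxe/-oo%E]_(j <- Js a k t.+1) (scut k j x)%:E)] &
      forall k t, reached k -> inner_steps k = t.+1%:R%:E ->
        x_(k.+1, 0) = x_(k, t.+1)].

End lshaped.

Section bounds.
Context (R : realType).
Implicit Types beta G D : R.

Definition max_outer beta (delta gap : R) : int :=
  if gap == 0 then 0
  else Num.max 0 (Num.ceil (ln (gap / delta) / - ln (1 - beta / 4))).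

Definition max_inner beta G D (eps : R) : R :=
  32 * G ^+ 2 * D ^+ 2 /
  (3 * (1 - beta) ^+ 2 * (2 - beta / 4) * eps ^+ 2).

End bounds.

(* Main.v *)
(* By LP duality the cuts minorize the sampled costs. Write [H] for the sampled
   cost at the center of an outer iteration, [delta = H - eps2 - fstar], so
   [rho D^2 = delta], and [w_t] for [H] minus the optimal value of the [t]-th
   proximal subproblem. Testing that subproblem at a minimizer of the expected
   cost gives [w_t >= delta / 2]; hence a serious step contracts the optimality
   gap by [1 - beta / 4] as long as the gap exceeds [deltaI]. The initial cut
   gives [w_0 <= G^2 / (2 rho)], and a null step gives
   [w_{t+1} <= w_t - c w_t^2] with [c = (1 - beta)^2 rho / (8 G^2)], that is,
   [1 / w_t] grows by at least [c]. So an outer iteration has at most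
   [16 G^2 D^2 / ((1 - beta)^2 delta^2)] inner steps; [delta] is at least [3 / 4]
   of the gap, and the squared inverse gaps are dominated by a geometric
   series. *)
Require Import Defs.
From HB Require Import structures.
From mathcomp Require Import all_boot all_order all_algebra.
From mathcomp Require Import all_classical all_reals all_analysis.
From mathcomp Require Import ring lra.

Set Implicit Arguments.
Unset Strict Implicit.
Unset Printing Implicit Defensive.

Import Order.TTheory GRing.Theory Num.Theory.
Import numFieldNormedType.Exports.

Local Open Scope classical_set_scope.
Local Open Scope ring_scope.

(** * Euclidean inner product and norm *)

Section euclidean_theory.
Context (R : realType) (n : nat).
Implicit Types (u v w : 'cV[R]_n) (c : R).

Lemma dotE u v : dot u v = \sum_i u i 0 * v i 0.
Proof. by rewrite /dot mxE; apply: eq_bigr => i _; rewrite mxE. Qed.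

Lemma dotC u v : dot u v = dot v u.
Proof. by rewrite !dotE; apply: eq_bigr => i _; rewrite mulrC. Qed.

Lemma dotDr u v w : dot u (v + w) = dot u v + dot u w.
Proof. by rewrite /dot mulmxDr mxE. Qed.

Lemma dotZr c u v : dot u (c *: v) = c * dot u v.
Proof. by rewrite /dot -scalemxAr mxE. Qed.

Lemma dotNr u v : dot u (- v) = - dot u v.
Proof. by rewrite -scaleN1r dotZr mulN1r. Qed.

Lemma dotDl u v w : dot (u + v) w = dot u w + dot v w.
Proof. by rewrite dotC dotDr !(dotC w). Qed.

Lemma dotZl c u v : dot (c *: u) v = c * dot u v.
Proof. by rewrite dotC dotZr dotC. Qed.

Lemma dotNl u v : dot (- u) v = - dot u v.
Proof. by rewrite dotC dotNr dotC. Qed.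

Lemma dot0l u : dot 0 u = 0.
Proof. by rewrite -(scale0r 0) dotZl mul0r. Qed.

Definition dot_lin := (dotDl, dotDr, dotZl, dotZr, dotNl, dotNr).

Lemma dot_suml (I : Type) (s : seq I) (F : I -> 'cV[R]_n) v :
  dot (\sum_(i <- s) F i) v = \sum_(i <- s) dot (F i) v.
Proof.
elim: s => [|i s IHs]; first by rewrite !big_nil dot0l.
by rewrite !big_cons dotDl IHs.
Qed.

Lemma dot_ge0 v : 0 <= dot v v.
Proof. by rewrite dotE; apply: sumr_ge0 => i _; rewrite -expr2 sqr_ge0. Qed.

Lemma dot_eq0 v : dot v v = 0 -> v = 0.
Proof.
rewrite dotE => /eqP; rewrite psumr_eq0 => [|i _]; last first.
  by rewrite -expr2 sqr_ge0.
move=> /allP v0; apply/colP => i; rewrite mxE; apply/eqP.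
by have := v0 i (mem_index_enum i); rewrite /= mulf_eq0 orbb.
Qed.

Lemma dot_nonneg u v : nonneg u -> nonneg v -> 0 <= dot u v.
Proof.
by move=> u0 v0; rewrite dotE; apply: sumr_ge0 => i _; apply: mulr_ge0.
Qed.

Lemma enorm_ge0 v : 0 <= enorm v.
Proof. exact: sqrtr_ge0. Qed.

Lemma sqr_enorm v : enorm v ^+ 2 = dot v v.
Proof. by rewrite sqr_sqrtr ?dot_ge0. Qed.

Lemma enormZ c v : 0 <= c -> enorm (c *: v) = c * enorm v.
Proof.
move=> c0; rewrite /enorm !dot_lin mulrA -expr2 sqrtrM ?sqr_ge0 //.
by rewrite sqrtr_sqr ger0_norm.
Qed.

Lemma enormN v : enorm (- v) = enorm v.
Proof. by rewrite /enorm !dot_lin opprK. Qed.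

(** Cauchy-Schwarz: the squared norm of [enorm v *: u - enorm u *: v] is
    [2 |u| |v| (|u| |v| - dot u v)]; zero vectors are set apart so that the positive factor
    cancels. *)
Lemma dot_le_enorm u v : dot u v <= enorm u * enorm v.
Proof.
have enorm_eq0 w : enorm w = 0 -> w = 0.
  by move=> w0; apply: dot_eq0; rewrite -sqr_enorm w0 expr0n.
have [/enorm_eq0 ->|u0] := eqVneq (enorm u) 0.
  by rewrite dot0l mulr_ge0 ?enorm_ge0.
have [/enorm_eq0 ->|v0] := eqVneq (enorm v) 0.
  by rewrite dotC dot0l mulr_ge0 ?enorm_ge0.
have uv0 : 0 < enorm u * enorm v.
  by rewrite mulr_gt0 // lt_def ?u0 ?v0 enorm_ge0.
have := dot_ge0 (enorm v *: u - enorm u *: v).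
rewrite !dot_lin (dotC v u) -!sqr_enorm => sq.
rewrite -(ler_pM2l uv0); nra.
Qed.

End euclidean_theory.

(** * Farkas' lemma and linear programming duality *)

Lemma dot_mulmx (R : realType) (m n : nat) (A : 'M[R]_(m, n)) u v :
  dot (A^T *m u) v = dot u (A *m v).
Proof. by rewrite /dot trmx_mul trmxK mulmxA. Qed.

Lemma nonneg_col_mx (R : realType) (m n : nat) (u : 'cV[R]_m) (v : 'cV[R]_n) :
  nonneg (col_mx u v) <-> nonneg u /\ nonneg v.
Proof.
split=> [uv|[u0 v0] i]; last by rewrite mxE; case: (fintype.split i) => j.
split=> i; first by have := uv (lshift n i); rewrite col_mxEu.
by have := uv (rshift m i); rewrite col_mxEd.
Qed.

Lemma dot_col_mx (R : realType) (m n : nat) (u u' : 'cV[R]_m)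
    (v v' : 'cV[R]_n) :
  dot (col_mx u v) (col_mx u' v') = dot u u' + dot v v'.
Proof. by rewrite /dot tr_col_mx mul_row_col mxE. Qed.

(* Bartl's induction on the number of inequalities: if the last one, [a], is
   not redundant, project along a direction on which [a] is negative. *)
Lemma farkas (R : realType) (m n : nat) (A : 'M[R]_(m, n)) (b : 'cV[R]_n) :
  (forall x, nonneg (A *m x) -> 0 <= dot b x) ->
  exists2 y, nonneg y & b = A^T *m y.
Proof.
elim: m A b => [|m IHm] A b Ab.
  exists 0; first by case.
  rewrite mulmx0; apply: dot_eq0; apply/eqP; rewrite eq_le dot_ge0 andbT.
  by rewrite -oppr_ge0 -dotNr; apply: Ab; case.
change 'M[R]_(1 + m, n) in A.
pose a := (usubmx A)^T; pose B := dsubmx A.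
have Ax x : A *m x = col_mx ((dot a x)%:M) (B *m x).
  by rewrite -{1}(vsubmxK A) mul_col_mx -mx11_scalar /dot trmxK.
have AT (t : R) y : A^T *m (col_mx t%:M y : 'cV_(1 + m)) = t *: a + B^T *m y.
  by rewrite -{1}(vsubmxK A) tr_col_mx mul_row_col mul_mx_scalar.
have nonneg1 (t : R) (y : 'cV_m) :
    0 <= t -> nonneg y -> nonneg (col_mx t%:M y : 'cV_(1 + m)).
  move=> t0 y0; apply/(@nonneg_col_mx _ 1 m); split=> // i.
  by rewrite mxE ord1 eqxx.
have [Bb|/existsNP[x0 /not_implyP[Bx0 bx0]]] :=
    pselect (forall x, nonneg (B *m x) -> 0 <= dot b x).
  have [y y0 by_] := IHm B b Bb; exists (col_mx 0%:M y : 'cV_(1 + m)).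
    exact: nonneg1.
  by rewrite AT scale0r add0r.
have {}bx0 : dot b x0 < 0 by rewrite ltNge; apply/negP.
have ax0 : dot a x0 < 0.
  rewrite ltNge; apply/negP => ax0; move: bx0; apply/negP; rewrite -leNgt.
  by apply: Ab; rewrite Ax; apply: nonneg1.
pose s := - dot a x0; have s0 : 0 < s by rewrite oppr_gt0.
(* [B'] and [b'] are [B] and [b] composed with [x |-> x + s^-1 (a.x) x0], the projection along [x0]
   onto the hyperplane [a.x = 0]. *)
pose B' := B + s^-1 *: (B *m x0 *m a^T).
pose b' := b + (s^-1 * dot b x0) *: a.
have B'x x : B' *m x = B *m (x + (s^-1 * dot a x) *: x0).
  rewrite mulmxDl mulmxDr -scalemxAl -scalemxAr -mulmxA -scalerA.
  congr (_ + _ *: _).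
  by rewrite [a^T *m x]mx11_scalar mul_mx_scalar.
have b'x x : dot b' x = dot b (x + (s^-1 * dot a x) *: x0).
  by rewrite !dot_lin; ring.
have [|y y0 b'y] := IHm B' b'.
  move=> x B'x0; rewrite b'x; apply: Ab; rewrite Ax -B'x.
  apply: nonneg1 => //.
  rewrite !dot_lin -[dot a x0]opprK -/s mulrN mulrAC mulVf ?gt_eqF //.
  by rewrite mul1r subrr.
(* The multiplier of [a] collects what is left when the projection is undone; it is nonnegative
   since [B x0] and [y] are and [dot b x0 < 0]. *)
exists (col_mx (s^-1 * (dot (B *m x0) y - dot b x0))%:M y : 'cV_(1 + m)).
  apply: nonneg1 => //; apply: mulr_ge0; first by rewrite invr_ge0 ltW.
  by rewrite subr_ge0 (le_trans (ltW bx0)) // dot_nonneg.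
rewrite AT mulrBr scalerBl; apply/eqP; rewrite addrAC eq_sym subr_eq eq_sym.
rewrite -/b' b'y /B' linearD /= linearZ /= trmx_mul trmxK mulmxDl addrC.
rewrite -scalemxAl -mulmxA [(B *m x0)^T *m y]mx11_scalar mul_mx_scalar.
by rewrite scalerA.
Qed.

(** Farkas is applied to the homogenized system [y >= 0], [s >= 0], [W y = s d] and the linear form
    [q.y - alpha s]. The equality is written as two inequalities, and [u] is the difference of their
    multipliers. *)
Lemma lp_dual (R : realType) (r l : nat) (W : 'M[R]_(r, l)) (q : 'cV[R]_l)
    (d : 'cV[R]_r) (alpha : R) (y0 : 'cV[R]_l) :
  nonneg y0 -> W *m y0 = d ->
  (forall y, nonneg y -> W *m y = d -> alpha <= dot q y) ->
  exists2 u, nonneg (q - W^T *m u) & alpha <= dot u d.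
Proof.
move=> y0_ge0 Wy0 lb.
pose M := row_mx W (- d).
pose A := col_mx 1%:M (col_mx M (- M)).
have [x|y] := @farkas R _ _ A (col_mx q (- alpha)%:M).
  rewrite -(vsubmxK x); move: (usubmx x) (dsubmx x) => {x} y s.
  rewrite !mul_col_mx mul1mx mulNmx !nonneg_col_mx => -[[y_ge0 s_ge0] [Mp Mn]].
  have {Mp Mn} Wy : W *m y = s 0 0 *: d.
    apply/eqP; rewrite -subr_eq0 -[s 0 0 *: d]mul_mx_scalar -mx11_scalar.
    rewrite -mulNmx -mul_row_col; apply/eqP/colP => i; apply/eqP.
    rewrite [X in _ == X]mxE eq_le Mp andbT.
    by have := Mn i; rewrite -/M [X in 0 <= X]mxE oppr_ge0.
  rewrite dot_col_mx; set t := s 0 0 in Wy.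
  have -> : dot (- alpha)%:M s = - (alpha * t).
    by rewrite dotE big_ord1 mxE eqxx mulNr.
  have t0 : 0 <= t := s_ge0 0.
  rewrite subr_ge0; have [t_eq0|t_neq0] := eqVneq t 0.
    rewrite t_eq0 mulr0 leNgt; apply/negP => qy.
    (* If the recession direction [y] had negative cost, adding this multiple of it to [y0] would
       give a feasible point of cost [alpha - 1]. *)
    pose N := (dot q y0 - alpha + 1) / - dot q y.
    have lb0 := lb _ y0_ge0 Wy0.
    have N0 : 0 <= N by apply: divr_ge0; lra.
    have := lb (y0 + N *: y).
    rewrite mulmxDr -scalemxAr Wy t_eq0 scale0r scaler0 addr0 => /(_ _ Wy0).
    rewrite !dot_lin {2}/N invrN mulrN mulNr divfK ?lt_eqF // => /(_ _) H.
    suff : alpha <= dot q y0 - (dot q y0 - alpha + 1) by lra.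
    by apply: H => i; rewrite !mxE addr_ge0 // mulr_ge0.
  have tgt0 : 0 < t by rewrite lt_def t_neq0.
  have := lb (t^-1 *: y); rewrite -scalemxAr Wy scalerA mulVf // scale1r dotZr.
  rewrite mulrC ler_pdivlMr //; apply=> // i.
  by rewrite mxE mulr_ge0 // invr_ge0.
rewrite -(vsubmxK y); move: (usubmx y) (dsubmx y) => {y} mu v.
rewrite -(vsubmxK v); move: (usubmx v) (dsubmx v) => {v} v1 v2.
rewrite !nonneg_col_mx => -[mu_ge0 _].
rewrite !tr_col_mx !mul_row_col trmx1 mul1mx linearN /= mulNmx -mulmxBr.
rewrite tr_row_mx mul_col_mx -(vsubmxK mu) add_col_mx => /eq_col_mx[qE aE].
have {mu_ge0} [mu1 mu2] : nonneg (usubmx mu) /\ nonneg (dsubmx mu).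
  by apply/nonneg_col_mx; rewrite vsubmxK.
exists (v1 - v2); first by rewrite qE addrK.
move: aE; rewrite linearN /= mulNmx => /(congr1 (fun B : 'M[R]_1 => B 0 0)).
rewrite [LHS]mxE [RHS]mxE [X in _ = _ + X]mxE -/(dot d _) dotC eqxx mulr1n.
by have := mu2 0; lra.
Qed.

(** * Sampled costs and their cuts *)

Section sampled_cost.
Context (R : realType) (Xi : eqType) (m n r l : nat) (p : tslp R Xi m n r l).
Implicit Types (x y : 'cV[R]_n) (z : Xi) (S : seq Xi).

Lemma dual_le_recourse x z u : dual_feasible p z u ->
  recourse p x z \is a fin_num ->
  dot u (lph p z - lpT p z *m x) <= fine (recourse p x z).
Proof.
move=> u_feas rx; rewrite -lee_fin fineK //.
apply/ereal_infP => _ [y [Wy y0] <-]; rewrite lee_fin -Wy addrAC subrr add0r.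
have := dot_nonneg u_feas y0; rewrite !dot_lin dot_mulmx; lra.
Qed.

(** Strong duality: a finite value excludes an empty primal feasible set, whose infimum is [+oo]. So
    [lp_dual] applies with the value as lower bound, and the maximizer [u] does at least as well as
    the dual point found. *)
Lemma recourse_le_dual x z u : dual_argmax p x z u ->
  recourse p x z \is a fin_num ->
  fine (recourse p x z) <= dot u (lph p z - lpT p z *m x).
Proof.
move=> [u_feas u_max] rx.
have [y0 [Wy0 y0_ge0]] : exists v,
    lpT p z *m x + lpW p *m v = lph p z /\ nonneg v.
  apply: contrapT => empty; move: rx; rewrite /recourse.
  suff -> : [set v | lpT p z *m x + lpW p *m v = lph p z /\ nonneg v] = set0.
    by rewrite image_set0 ereal_inf0.
  by apply/seteqP; split=> v // v_feas; apply: empty; exists v.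
have [||v v_feas /le_trans] := @lp_dual R r l (lpW p) (lpq p z)
    (lph p z - lpT p z *m x) (fine (recourse p x z)) y0 y0_ge0.
- by rewrite -Wy0 addrAC subrr add0r.
- move=> y y_ge0 Wy; rewrite -lee_fin fineK //; apply: ereal_inf_lbound.
  by exists y => //; split=> //; rewrite Wy addrC subrK.
- by apply; exact: u_max.
Qed.

Lemma recourse_fin_num S x z : sample_cost p S x \is a fin_num -> z \in S ->
  recourse p x z \is a fin_num.
Proof.
move=> Sx zS; suff /sum_fin_numP/(_ z zS isT) :
  (\sum_(z <- S) recourse p x z)%E \is a fin_num by [].
have S0 : 0 < (size S)%:R^-1 :> R.
  by case: S zS {Sx} => // *; rewrite invr_gt0 ltr0n.
move: Sx; rewrite /sample_cost; case: (\sum_(z <- S) _)%E => [s| |] //.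
  by rewrite gt0_muley ?lte_fin.
by rewrite gt0_muleNy ?lte_fin.
Qed.

Lemma fine_sample_cost S x : sample_cost p S x \is a fin_num ->
  fine (sample_cost p S x) =
  dot (lpc p) x + (size S)%:R^-1 * \sum_(z <- S) fine (recourse p x z).
Proof.
move=> Sx; rewrite /sample_cost big_seq.
have rx z : z \in S -> recourse p x z \is a fin_num by exact: recourse_fin_num.
by rewrite -EFin_sum_fine // -big_seq.
Qed.

(** The multiplier [U x z] is optimal at [x] and still dual feasible at [y], because the dual
    constraints do not involve the first-stage point. Strong duality at [x] and weak duality at [y]
    are then averaged over the samples. *)
Lemma sample_subgrad_le U S x y :
  sample_cost p S x \is a fin_num -> sample_cost p S y \is a fin_num ->
  (forall z, z \in S -> dual_argmax p x z (U x z)) ->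
  fine (sample_cost p S x) + dot (sample_subgrad p U S x) (y - x)
    <= fine (sample_cost p S y).
Proof.
move=> Sx Sy U_max; rewrite !fine_sample_cost // /sample_subgrad.
rewrite dotDl dotNl dotZl dot_suml [dot _ (y - x)]dotDr dotNr.
set N := _^-1; have N0 : 0 <= N by rewrite invr_ge0.
suff : N * \sum_(z <- S) fine (recourse p x z) <=
    N * (\sum_(z <- S) dot ((lpT p z)^T *m U x z) (y - x)
         + \sum_(z <- S) fine (recourse p y z)) by rewrite mulrDr; lra.
apply: ler_wpM2l => //; rewrite -big_split /= !big_seq.
apply: ler_sum => z zS; have [U_feas _] := U_max z zS.
apply: (le_trans (recourse_le_dual (U_max z zS) (recourse_fin_num Sx zS))).
have := dual_le_recourse U_feas (recourse_fin_num Sy zS).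
rewrite dot_mulmx mulmxBr !dot_lin; lra.
Qed.

End sampled_cost.

(** * Proximal steps and the length of a run of null steps *)

Section proximal_step.
Context (R : realType) (n : nat).
Implicit Types (X : set 'cV[R]_n) (phi psi : 'cV[R]_n -> R).
Implicit Types (x y z g : 'cV[R]_n).
Implicit Types (rho G D H e : R).

(** Otherwise pull [z] back towards [x] to distance [G / rho]: the Lipschitz bound limits the
    increase of [phi], and the proximal term saves strictly more. *)
Lemma prox_displacement X phi rho G x z :
  X x -> (forall t, 0 <= t <= 1 -> X (x + t *: (z - x))) ->
  0 < rho -> 0 < G -> lipschitz_enorm G phi ->
  is_argmin X (fun y => phi y + rho / 2 * enorm (y - x) ^+ 2) z ->
  rho * enorm (z - x) <= G.
Proof.
move=> Xx seg rho0 G0 lip [_ z_min]; rewrite leNgt; apply/negP => ltG.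
set d := enorm (z - x) in ltG *.
have rd0 : 0 < rho * d := lt_trans G0 ltG.
have d0 : 0 < d by rewrite -(pmulr_rgt0 _ rho0).
pose t := G / (rho * d).
have t0 : 0 < t by rewrite divr_gt0.
have t1 : t < 1 by rewrite ltr_pdivrMr // mul1r.
have tE : t * rho * d = G by rewrite -mulrA divfK // gt_eqF.
have t0' := ltW t0; have t1' : 0 <= 1 - t by rewrite subr_ge0 ltW.
have := z_min (x + t *: (z - x)).
rewrite [x + _ - x]addrAC subrr add0r enormZ // -/d.
have := lip (x + t *: (z - x)) z.
have -> : x + t *: (z - x) - z = (1 - t) *: (- (z - x)).
  by rewrite opprB scalerBl scale1r -scalerN opprB addrAC.
rewrite enormZ // enormN -/d => /ler_normlP[_ lip_t].
have /seg Xt : 0 <= t <= 1 by rewrite t0' ltW.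
move=> /(_ Xt) min_t.
have : (1 - t) * d * (rho * d * (1 + t)) <= (1 - t) * d * (2 * G) by nra.
rewrite ler_pM2l; last by rewrite mulr_gt0 // subr_gt0.
nra.
Qed.

(** The competitor [y] has a proximal term of at most [rho * D ^+ 2 / 2], half of its decrease below
    [H]. *)
Lemma prox_gap_ge X phi rho D H x y z :
  0 < rho -> X y -> enorm (y - x) <= D -> phi y <= H - rho * D ^+ 2 ->
  is_argmin X (fun y => phi y + rho / 2 * enorm (y - x) ^+ 2) z ->
  rho * D ^+ 2 / 2 <= H - (phi z + rho / 2 * enorm (z - x) ^+ 2).
Proof.
move=> rho0 Xy yD phiy [_ /(_ y Xy)].
have : enorm (y - x) ^+ 2 <= D ^+ 2.
  by rewrite lerXn2r ?nnegrE ?(le_trans _ yD) ?enorm_ge0.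
nra.
Qed.

(* [psi] dominates the convex combination of the two cuts with weight
   [rho e / (4 G^2)] on the second one; the first cut plus the proximal term is
   the old optimal value plus [rho / 2 * |y - z|^2]. *)
Lemma null_step_increase phi psi rho G e hz x y z g :
  0 < rho -> 0 < G -> 0 <= e -> rho * e <= 4 * G ^+ 2 ->
  enorm g <= G -> rho * enorm (z - x) <= G -> e <= hz - phi z ->
  phi z + dot (rho *: (x - z)) (y - z) <= psi y ->
  hz + dot g (y - z) <= psi y ->
  phi z + rho / 2 * enorm (z - x) ^+ 2 + rho / (8 * G ^+ 2) * e ^+ 2
    <= psi y + rho / 2 * enorm (y - x) ^+ 2.
Proof.
move=> rho0 G0 e0 eG gG sG eh agg cut.
set s := rho *: (x - z) in agg; set v := y - z in agg cut.
have s_norm : enorm s <= G by rewrite enormZ ?(ltW rho0) // -enormN opprB.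
have yx : y - x = (z - x) + v by rewrite /v [RHS]addrC addrA subrK.
have zx : z - x = - rho^-1 *: s.
  by rewrite scaleNr scalerA mulVf ?gt_eqF // scale1r opprB.
clearbody s v.
have -> : enorm (y - x) ^+ 2 = enorm (z - x) ^+ 2 - 2 / rho * dot s v + dot v v.
  rewrite !sqr_enorm yx zx !dot_lin (dotC v s); field; exact: lt0r_neq0.
(* This weight maximizes the guaranteed increase [t e - 2 t^2 G^2 / rho], with maximum [t e / 2];
   the bound on [rho * e] keeps it at most 1. *)
pose t := rho * e / (4 * G ^+ 2).
have GG0 : 0 < 4 * G ^+ 2 by rewrite mulr_gt0 // exprn_gt0.
have t0 : 0 <= t by rewrite divr_ge0 ?mulr_ge0 // ltW.
have t1 : t <= 1 by rewrite ler_pdivrMr // mul1r.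
have gs : dot (g - s) (g - s) <= 4 * G ^+ 2.
  have := dot_le_enorm g (- s); have := enorm_ge0 g; have := enorm_ge0 s.
  rewrite enormN !dot_lin (dotC s g) -!sqr_enorm; nra.
(* Completing the square in [v] bounds the proximal term and the tilt from the aggregate cut to the
   new one from below. *)
have := dot_ge0 (rho *: v + t *: (g - s)).
rewrite [X in 0 <= X](_ : _ = rho ^+ 2 * dot v v
   + 2 * rho * t * (dot g v - dot s v)
   + t ^+ 2 * dot (g - s) (g - s)); last first.
  by rewrite !dot_lin !(dotC v) (dotC s g); ring.
move=> sq.
have {}sq : 0 <= rho / 2 * dot v v + t * (dot g v - dot s v)
    + 2 * t ^+ 2 * G ^+ 2 / rho.
  rewrite -(pmulr_rge0 _ (_ : 0 < 2 * rho)); last by rewrite mulr_gt0.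
  apply: (le_trans sq).
  have -> : 2 * rho * (rho / 2 * dot v v + t * (dot g v - dot s v)
      + 2 * t ^+ 2 * G ^+ 2 / rho) = rho ^+ 2 * dot v v
      + 2 * rho * t * (dot g v - dot s v) + t ^+ 2 * (4 * G ^+ 2).
    by field; exact: lt0r_neq0.
  by rewrite lerD2l ler_wpM2l // sqr_ge0.
have psiy : phi z + dot s v + t * (e + (dot g v - dot s v)) <= psi y by nra.
have tG : 2 * t ^+ 2 * G ^+ 2 / rho = t * e / 2.
  by rewrite /t; field; rewrite !lt0r_neq0.
have te : rho / (8 * G ^+ 2) * e ^+ 2 = t * e / 2.
  by rewrite /t; field; rewrite !lt0r_neq0.
have sv : rho / 2 * (2 / rho * dot s v) = dot s v by field; exact: lt0r_neq0.
rewrite te; nra.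
Qed.

(** One step rests on [(1 / w + c) (w - c w^2) = 1 - c^2 w^2 <= 1]. The induction hypothesis itself
    gives [w N <= w 0], the guard under which the decrease is assumed. *)
Lemma gap_decay (w : nat -> R) (c : R) (N : nat) :
  0 < c -> (forall t, (t <= N)%N -> 0 < w t) ->
  (forall t, (t < N)%N -> w t <= w 0%N -> w t.+1 <= w t - c * w t ^+ 2) ->
  (w 0%N)^-1 + c * N%:R <= (w N)^-1.
Proof.
move=> c0; elim: N => [|N IHN] w0 dec; first by rewrite mulr0 addr0.
have {}IHN : (w 0%N)^-1 + c * N%:R <= (w N)^-1.
  apply: IHN => t tN; [exact: w0 (leqW tN)|exact: dec (leqW tN)].
have wN := w0 N (leqnSn N); have wSN := w0 N.+1 (leqnn _).
have wN0 : w N <= w 0%N.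
  rewrite -lef_pV2 ?posrE ?w0 // (le_trans _ IHN) // lerDl.
  by rewrite mulr_ge0 // ltW.
have {}dec := dec N (leqnn _) wN0.
suff : (w N)^-1 + c <= (w N.+1)^-1 by rewrite -natr1; lra.
rewrite -(ler_pM2r wSN) mulVf ?gt_eqF //.
have iN : (w N)^-1 * w N = 1 by rewrite mulVf ?gt_eqF.
have iN0 : 0 < (w N)^-1 by rewrite invr_gt0.
apply: (@le_trans _ _ (((w N)^-1 + c) * (w N - c * w N ^+ 2))).
  by rewrite ler_wpM2l // addr_ge0 // ltW.
have -> : ((w N)^-1 + c) * (w N - c * w N ^+ 2)
   = (w N)^-1 * w N * (1 - c * w N) + c * w N - c ^+ 2 * w N ^+ 2 by ring.
rewrite iN; nra.
Qed.

End proximal_step.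

(** Steps before [T] are null and step [T] is arbitrary. The growth of [1 / w] is squeezed between
    [1 / w 0 >= c] and [1 / w T <= 2 / (rho D^2)]; the former counts one step more, hence [T.+1]. *)
Lemma null_steps_le (R : realType) (n : nat) (X : set 'cV[R]_n)
    (h : 'cV[R]_n -> R) (g : 'cV[R]_n -> 'cV[R]_n) (F : nat -> 'cV[R]_n -> R)
    (x : nat -> 'cV[R]_n) (xs : 'cV[R]_n) (rho beta G D : R) (T : nat) :
  (forall y z t, X y -> X z -> 0 <= t <= 1 -> X (y + t *: (z - y))) ->
  X (x 0%N) -> X xs -> enorm (xs - x 0%N) <= D -> 0 < D ->
  0 < rho -> 0 < beta < 1 -> 0 < G ->
  (forall y, X y -> enorm (g y) <= G) ->
  (forall y, F 0%N y = h (x 0%N) + dot (g (x 0%N)) (y - x 0%N)) ->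
  (forall t, (t <= T)%N -> F t xs <= h (x 0%N) - rho * D ^+ 2) ->
  (forall t, (t <= T)%N -> is_argmin X
     (fun y => F t y + rho / 2 * enorm (y - x 0%N) ^+ 2) (x t.+1)) ->
  (forall t, (t < T)%N ->
     h (x 0%N) - h (x t.+1) < beta * (h (x 0%N) - F t (x t.+1))) ->
  (forall t, (t < T)%N -> lipschitz_enorm G (F t.+1)) ->
  (forall t y, (t < T)%N ->
     h (x t.+1) + dot (g (x t.+1)) (y - x t.+1) <= F t.+1 y /\
     F t (x t.+1) + dot (rho *: (x 0%N - x t.+1)) (y - x t.+1) <= F t.+1 y) ->
  T.+1%:R <= 16 * G ^+ 2 / ((1 - beta) ^+ 2 * rho ^+ 2 * D ^+ 2).
Proof.
move=> seg Xx0 Xxs xsD D0 rho0 /andP[beta0 beta1] G0 gG F0 Fxs argm null lip.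
move=> cut.
pose w t := h (x 0%N) - (F t (x t.+1) + rho / 2 * enorm (x t.+1 - x 0%N) ^+ 2).
have D20 : 0 < D ^+ 2 by rewrite exprn_gt0.
have G20 : 0 < G ^+ 2 by rewrite exprn_gt0.
have rD0 : 0 < rho * D ^+ 2 / 2 by rewrite divr_gt0 // mulr_gt0.
have w_ge t : (t <= T)%N -> rho * D ^+ 2 / 2 <= w t.
  by move=> tT; apply: (prox_gap_ge rho0 Xxs xsD (Fxs t tT) (argm t tT)).
have w_gt0 t : (t <= T)%N -> 0 < w t by move=> /w_ge; apply: lt_le_trans.
have Xx t : (t <= T.+1)%N -> X (x t).
  by case: t => [//|t tT]; have [] := argm t tT.
have w0_le : 2 * rho * w 0%N <= G ^+ 2.
  have E0 := enorm_ge0 (x 1%N - x 0%N).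
  have : - dot (g (x 0%N)) (x 1%N - x 0%N) <= G * enorm (x 1%N - x 0%N).
    rewrite -dotNr (le_trans (dot_le_enorm _ _)) // enormN.
    by rewrite ler_wpM2r // gG.
  have := sqr_ge0 (rho * enorm (x 1%N - x 0%N) - G).
  rewrite /w F0; nra.
(* The initial bundle function is affine with slope of norm at most [G], which extends the Lipschitz
   bound to index 0. *)
have {}lip t : (t <= T)%N -> lipschitz_enorm G (F t).
  case: t => [_ y z|t /lip //]; rewrite !F0.
  have -> : forall a b c : R, a + b - (a + c) = b - c by move=> *; ring.
  rewrite -dotNr -dotDr.
  have -> : y - x 0%N + - (z - x 0%N) = y - z by rewrite opprB addrA subrK.
  have g0G := gG _ Xx0; apply/ler_normlP; split.
    rewrite -dotNr (le_trans (dot_le_enorm _ _)) // enormN.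
    by rewrite ler_wpM2r // enorm_ge0.
  by rewrite (le_trans (dot_le_enorm _ _)) // ler_wpM2r // enorm_ge0.
pose c := (1 - beta) ^+ 2 * rho / (8 * G ^+ 2).
have b10 : 0 < (1 - beta) ^+ 2 by rewrite exprn_gt0 // subr_gt0.
have c0 : 0 < c by rewrite /c divr_gt0 // mulr_gt0.
have dec t : (t < T)%N -> w t <= w 0%N -> w t.+1 <= w t - c * w t ^+ 2.
  move=> tT wt0; have tT' := ltnW tT; have wt := w_gt0 t tT'.
  have disp : rho * enorm (x t.+1 - x 0%N) <= G.
    apply: (prox_displacement Xx0 _ rho0 G0 (lip t tT') (argm t tT')) => s s01.
    exact: (seg _ _ _ Xx0 (Xx _ (tT' : (t.+1 <= T.+1)%N))).
  have [cut1 cut2] := cut t (x t.+2) tT.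
  (* The failed descent test leaves the fraction [1 - beta] of [h (x 0) - F t (x t.+1)], which is
     [w t] plus the proximal term. *)
  have gap : (1 - beta) * w t <= h (x t.+1) - F t (x t.+1).
    have := null t tT; have := sqr_ge0 (enorm (x t.+1 - x 0%N)).
    rewrite /w; set E := enorm _ ^+ 2 => E0.
    suff : 0 <= (1 - beta) * (rho / 2 * E) by lra.
    apply: mulr_ge0; first by rewrite subr_ge0 ltW.
    by rewrite mulr_ge0 // divr_ge0 // ltW.
  have e0 : 0 <= (1 - beta) * w t.
    by apply: mulr_ge0; [rewrite subr_ge0 ltW|exact: ltW].
  (* Here [w t <= w 0] is combined with [w0_le] to make the cut weight admissible. *)
  have e1 : rho * ((1 - beta) * w t) <= 4 * G ^+ 2.
    have : rho * w t <= rho * w 0%N by rewrite ler_wpM2l // ltW.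
    have : 0 < beta * (rho * w t) by rewrite !mulr_gt0.
    lra.
  have := null_step_increase rho0 G0 e0 e1
    (gG _ (Xx _ (tT' : (t.+1 <= T.+1)%N))) disp gap cut2 cut1.
  have -> : c * w t ^+ 2 = rho / (8 * G ^+ 2) * ((1 - beta) * w t) ^+ 2.
    by rewrite /c; field; exact: lt0r_neq0.
  rewrite /w; lra.
have := gap_decay c0 w_gt0 dec.
have : (w T)^-1 <= 2 / (rho * D ^+ 2).
  by rewrite -[2 / _]invf_div lef_pV2 ?posrE ?w_gt0 ?w_ge.
have : 2 * rho / G ^+ 2 <= (w 0%N)^-1.
  rewrite -[_ / _]invf_div lef_pV2 ?posrE ?w_gt0 //; last first.
    by rewrite divr_gt0 ?mulr_gt0.
  by rewrite ler_pdivlMr ?mulr_gt0 // mulrC.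
have : c <= 2 * rho / G ^+ 2.
  have -> : c = (1 - beta) ^+ 2 / 8 * (rho / G ^+ 2).
    by rewrite /c; field; exact: lt0r_neq0.
  by rewrite -[2 * rho / _]mulrA ler_wpM2r ?(ltW (divr_gt0 rho0 G20)) //; nra.
move=> c_le w0 wT dec_T.
have : T.+1%:R * c <= 2 / (rho * D ^+ 2) by rewrite -natr1; lra.
rewrite -ler_pdivlMr // => /le_trans; apply.
rewrite le_eqVlt; apply/orP; left; apply/eqP; rewrite /c; field.
by rewrite !lt0r_neq0 ?subr_gt0.
Qed.

(** The infimum of the empty set is [+oo]; a nonempty set of natural numbers attains its minimum,
    here at the first serious step. *)
Lemma inner_stepsP (R : realType) (Xi : Type) (m n r l : nat)
    (p : tslp R Xi m n r l) beta (a : lshaped_data R Xi n) k :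
  (inner_steps p beta a k = +oo%E /\ forall t, ~ serious p beta a k t) \/
  exists t, [/\ inner_steps p beta a k = t.+1%:R%:E, serious p beta a k t &
                forall s, (s < t)%N -> ~ serious p beta a k s].
Proof.
have [[t0 st0]|none] := pselect (exists t, serious p beta a k t); last first.
  have no t : ~ serious p beta a k t by move=> st; apply: none; exists t.
  left; split=> //; rewrite /inner_steps (_ : [set t | _] = set0).
    by rewrite image_set0 ereal_inf0.
  by apply/seteqP; split=> t // /no.
right; have ex : exists t, `[<serious p beta a k t>].
  by exists t0; apply/asboolP.
case: (ex_minnP ex) => t /asboolP st t_min; exists t; split=> //.
  apply/eqP; rewrite eq_le; apply/andP; split.
    by apply: ereal_inf_lbound; exists t.
  apply/ereal_infP => _ [s ss <-]; rewrite lee_fin ler_nat ltnS.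
  by apply: t_min; apply/asboolP.
by move=> s lt_st /asboolP/t_min; rewrite leqNgt lt_st.
Qed.

(** * Logarithmic outer bound and geometric sums *)

Lemma max_outer_ge0 (R : realType) (beta delta gap : R) :
  0 <= max_outer beta delta gap.
Proof. by rewrite /max_outer; case: ifP => // _; rewrite le_max lexx. Qed.

Lemma max_outerP (R : realType) (beta delta gap : R) :
  0 < beta < 1 -> 0 < delta -> 0 < gap ->
  (1 - beta / 4) ^+ `|max_outer beta delta gap| * gap <= delta.
Proof.
move=> /andP[beta0 beta1] delta0 gap0; set K := max_outer _ _ _; set q := 1 - _.
have q0 : 0 < q by rewrite /q; lra.
have lnq : 0 < - ln q by rewrite oppr_gt0 ln_lt0 // q0 /q; lra.
have qK0 : 0 < q ^+ `|K| by rewrite exprn_gt0.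
rewrite -ler_ln ?posrE ?mulr_gt0 // lnM ?posrE // lnXn //.
have K0 : 0 <= K := max_outer_ge0 _ _ _.
have : ln (gap / delta) / - ln q <= `|K|%:R.
  rewrite natr_absz ger0_norm // (le_trans (ceil_ge _)) // ler_int.
  rewrite /K /max_outer.
  rewrite -/q gt_eqF //; set c := Num.ceil _.
  by rewrite le_max lexx orbT.
rewrite ler_pdivrMr // ln_div ?posrE // -[ln q *+ _]mulr_natl.
rewrite mulrN lerNr opprB => H; rewrite -lerBrDr; exact: H.
Qed.

Lemma max_inner_ge0 (R : realType) (beta G D eps : R) :
  beta < 1 -> 0 <= max_inner beta G D eps.
Proof.
move=> b1; have b4 : 0 <= 2 - beta / 4 by lra.
apply: divr_ge0; apply: mulr_ge0; rewrite ?sqr_ge0 //.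
  by apply: mulr_ge0; rewrite ?sqr_ge0.
by do 2![apply: mulr_ge0 => //]; rewrite sqr_ge0.
Qed.

(** Read backwards from [v k], the terms decay at least geometrically with ratio [q]. *)
Lemma geometric_sum_le (R : realFieldType) (v : nat -> R) (q : R) (k : nat) :
  0 <= q < 1 -> (forall j, (j <= k)%N -> 0 <= v j) ->
  (forall j, (j < k)%N -> v j <= q * v j.+1) ->
  \sum_(j < k.+1) v j <= v k / (1 - q).
Proof.
move=> /andP[q0 q1]; have iq : 0 < 1 - q by rewrite subr_gt0.
elim: k => [|k IHk] v0 vq.
  rewrite big_ord1 ler_pdivlMr // ler_piMr ?v0 //; lra.
rewrite big_ord_recr /= (le_trans (lerD (IHk _ _) (lexx _))) //.
- by move=> j jk; apply/v0/leqW.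
- by move=> j jk; apply/vq/leqW.
rewrite ler_pdivlMr // mulrDl divfK ?gt_eqF //; have := vq k (leqnn _); lra.
Qed.

Lemma feasible_segment (R : realType) (Xi : Type) (m n r l : nat)
    (p : tslp R Xi m n r l) (y z : 'cV[R]_n) (t : R) :
  feasible p y -> feasible p z -> 0 <= t <= 1 -> feasible p (y + t *: (z - y)).
Proof.
move=> [Ay y0] [Az z0] /andP[t0 t1]; split=> [|i].
  by rewrite mulmxDr -scalemxAr mulmxBr Ay Az subrr scaler0 addr0.
rewrite !mxE; have := y0 i; have := z0 i; nra.
Qed.

(** * Contraction of the optimality gap and the two complexity bounds *)

Theorem theorem2 (R : realType) (d d' : measure_display)
    (Omega : measurableType d) (Xi : measurableType d')
    (P : probability Omega R) (xi : {RV P >-> Xi})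
    (m n r l : nat) (p : tslp R Xi m n r l)
    (U : 'cV[R]_n -> Xi -> 'cV[R]_r) (beta : R) (a : lshaped_data R Xi n)
    (fstar D G eps1 eps2 : R) :
  let X := feasible p in
  let f := expected_cost xi p in
  let rho := stepsize a in
  let x := iterate a in
  let F := bundle a in
  let Tk := inner_steps p beta a in
  let outer := reached p beta a in
  let epsbar := (beta + 1) * (eps1 + eps2) in
  let deltaI := 4 * epsbar / beta in
  (* the problem *)
  (forall y, X y -> P.-integrable setT (fun w => recourse p y (xi w))) ->
  convex_function X f ->
  (exists2 y, X y & f y = fstar) ->
  (forall y, X y -> fstar <= f y) ->
  (* the algorithm *)
  0 < beta < 1 ->
  (forall k y z, outer k -> X y -> z \in samples a k ->
     dual_argmax p y z (U y z)) ->
  lshaped_run p U beta a ->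
  (* (i) *)
  X !=set0 ->
  (forall y z, X y -> X z -> enorm (y - z) <= D) ->
  (* (ii) *)
  (forall k y, outer k -> X y ->
     ((f y - eps1)%:E <= fhatE p a k y <= (f y + eps2)%:E)%E) ->
  (* (iii) *)
  0 < G ->
  (forall k y, outer k -> X y -> enorm (ghat p U a k y) <= G) ->
  (* (iv) *)
  (forall k t, outer k -> ((t.+2)%:R%:E <= Tk k)%E ->
     [/\ convex_function [set: 'cV[R]_n] (F k t.+1),
         lipschitz_enorm G (F k t.+1) &
         forall y, ((F k t.+1 y)%:E <= fhatE p a k y)%E /\
           Num.max (gcut p U a k t.+1 y) (scut a k t.+1 y) <= F k t.+1 y]) ->
  0 < epsbar < 1 ->
  (forall k, outer k ->
     rho k = (fhat p a k (x k 0%N) - eps2 - fstar) / D ^+ 2 /\ 0 < rho k) ->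
  [/\ exists k, [/\ outer k,
        k%:Z <= max_outer beta deltaI (f (x 0%N 0%N) - fstar) &
        f (x k 0%N) - fstar <= deltaI],
      (* total number of inner steps before the first accurate iterate *)
      forall k, outer k -> f (x k 0%N) - fstar <= deltaI ->
        (forall j, (j < k)%N -> deltaI < f (x j 0%N) - fstar) ->
        (\sum_(j < k) Tk j <= (max_inner beta G D epsbar)%:E)%E &
      (max_inner beta G D : R^o -> R^o) =O_ (0^'+) (fun e => (e ^+ 2)^-1)].
Proof.
move=> X f rho x F Tk outer epsbar deltaI _ _ [xs Xxs fxs] fmin b01 Udual
  [x00 init argm _ next] _ diam est G0 gG iv /andP[epsbar0 _] rhoE.
clearbody f; have [b0 b1] := andP b01.
have eps0 : 0 < eps1 + eps2.
  by move: epsbar0; rewrite /epsbar pmulr_rgt0 // addr_gt0.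
have outer0 : outer 0%N by [].
have D0 : 0 < D.
  rewrite lt_def (le_trans (enorm_ge0 _) (diam _ _ x00 x00)) andbT.
  (* Division by zero gives 0, so [D = 0] would contradict the positive step-size. *)
  apply/eqP => D0; have [] := rhoE _ outer0.
  by rewrite D0 expr0n invr0 mulr0 => -> ; rewrite ltxx.
have D20 : 0 < D ^+ 2 by rewrite exprn_gt0.
have Xx k : outer k -> X (x k 0%N).
  elim: k => [//|k IHk] ok; have ok' : outer k by move=> j jk; exact/ok/leqW.
  have := ok k (leqnn _).
  have [[-> _]|[t [Tt _ _]]] := inner_stepsP p beta a k; first by rewrite ltxx.
  rewrite /x (next k t) //.
  by have [|] := argm k t ok'; rewrite ?Tt ?lte_fin ?ltr_nat.
have fhat_fin k y : outer k -> X y -> fhatE p a k y \is a fin_num.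
  move=> ok Xy; have /andP[lo hi] := est k y ok Xy.
  rewrite fin_numE gt_eqF ?(lt_le_trans _ lo) ?ltNyr //.
  by rewrite lt_eqF ?(le_lt_trans hi) ?ltry.
have fhat_est k y : outer k -> X y ->
    f y - eps1 <= fhat p a k y /\ fhat p a k y <= f y + eps2.
  move=> ok Xy; have := est k y ok Xy.
  by rewrite -(fineK (fhat_fin k y ok Xy)) !lee_fin => /andP.
have rho0 k : outer k -> 0 < rho k by case/rhoE.
have rhoD k : outer k -> rho k * D ^+ 2 = fhat p a k (x k 0%N) - eps2 - fstar.
  by case/rhoE => -> _; rewrite divfK // gt_eqF.
have before_serious k t : (t.+1%:R%:E < Tk k)%E ->
    [/\ (t%:R%:E < Tk k)%E, ((t.+2)%:R%:E <= Tk k)%E & ~ serious p beta a k t].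
  rewrite /Tk; have [[-> no]|[s [-> _ no]]] := inner_stepsP p beta a k.
    by split=> //; rewrite ?ltry ?leey.
  rewrite !lte_fin lee_fin !ltr_nat ler_nat !ltnS => ts; split=> //.
    exact: ltnW.
  exact: no.
(* The sampled cost at [xs] is at most [fstar + eps2], which the step-size rule identifies with the
   right-hand side. Bundle function 0 lies below it by duality, later ones by (iv). *)
have model_xs k t : outer k -> (t%:R%:E < Tk k)%E ->
    F k t xs <= fhat p a k (x k 0%N) - rho k * D ^+ 2.
  move=> ok tT; have [_ up] := fhat_est k xs ok Xxs.
  suff : F k t xs <= fhat p a k xs by rewrite rhoD //; lra.
  case: t tT => [_|t tT].
    have [_ _ initE] := init k ok; rewrite /F initE.
    apply: sample_subgrad_le; try exact: fhat_fin.
      by apply: fhat_fin => //; exact: Xx.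
    by move=> z zS; apply: Udual zS => //; exact: Xx.
  have [_ /(iv k t ok)[_ _ /(_ xs)[+ _] _]] := before_serious k t tT.
  by rewrite -(fineK (fhat_fin k xs ok Xxs)) lee_fin.
have inner_le k T : outer k -> (T%:R%:E < Tk k)%E ->
    T.+1%:R <= 16 * G ^+ 2 / ((1 - beta) ^+ 2 * rho k ^+ 2 * D ^+ 2).
  move=> ok TT.
  have leT t : (t <= T)%N -> (t%:R%:E < Tk k)%E.
    by move=> tT; apply: le_lt_trans TT; rewrite lee_fin ler_nat.
  apply: (@null_steps_le R n X
    (fhat p a k) (ghat p U a k) (F k) (x k) xs) => //.
  - exact: feasible_segment.
  - exact: Xx.
  - by apply: diam => //; exact: Xx.
  - exact: rho0.
  - by move=> y Xy; exact: gG.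
  - by have [_ _] := init k ok.
  - by move=> t tT; apply: model_xs => //; exact: leT.
  - by move=> t tT; apply: argm => //; exact: leT.
  - move=> t tT; have [_ _ ns] := before_serious k t (leT _ tT).
    by rewrite ltNge; apply/negP.
  - move=> t tT; have [_ T2 _] := before_serious k t (leT _ tT).
    by have [] := iv k t ok T2.
  - move=> t y tT; have [_ T2 _] := before_serious k t (leT _ tT).
    have [_ _ /(_ y)[_]] := iv k t ok T2.
    by rewrite ge_max => /andP.
have step k : outer k -> exists N, [/\ Tk k = N%:R%:E,
    N%:R <= 16 * G ^+ 2 / ((1 - beta) ^+ 2 * rho k ^+ 2 * D ^+ 2) &
    f (x k.+1 0%N) - fstar <=
      (1 - beta / 2) * (f (x k 0%N) - fstar) + (eps1 + eps2)].
  move=> ok; have [[Ty _]|[t [Tt st _]]] := inner_stepsP p beta a k.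
    (* An endless inner loop would satisfy [inner_le] for every [T], against the Archimedean
       property. *)
    pose B := 16 * G ^+ 2 / ((1 - beta) ^+ 2 * rho k ^+ 2 * D ^+ 2).
    have B0 : 0 <= B.
      apply: divr_ge0; first by apply: mulr_ge0; rewrite ?sqr_ge0.
      by apply: mulr_ge0; rewrite ?sqr_ge0 //; apply: mulr_ge0; apply: sqr_ge0.
    have := archi_boundP B0; rewrite ltNge => /negP[].
    apply: le_trans (inner_le k (Num.bound B) ok _); first by rewrite ler_nat.
    by rewrite /Tk Ty ltry.
  have tT : (t%:R%:E < Tk k)%E by rewrite /Tk Tt lte_fin ltr_nat.
  exists t.+1; split=> //; first exact: inner_le.
  rewrite /x (next k t) //.
  have am := argm k t ok tT; have Xt : X (x k t.+1) by case: am.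
  have xsD : enorm (xs - x k 0%N) <= D by apply: diam => //; exact: Xx.
  have gap := prox_gap_ge (rho0 k ok) Xxs xsD (model_xs k t ok tT) am.
  have [lo _] := fhat_est k _ ok Xt; have [_ hi] := fhat_est k _ ok (Xx k ok).
  have : 0 <= rho k / 2 * enorm (x k t.+1 - x k 0%N) ^+ 2.
    by apply: mulr_ge0; [rewrite divr_ge0 // ltW // rho0|exact: sqr_ge0].
  rewrite -[iterate a k t.+1]/(x k t.+1).
  have {}st : beta * (fhat p a k (x k 0%N) - F k t (x k t.+1)) <=
    fhat p a k (x k 0%N) - fhat p a k (x k t.+1) := st.
  move: gap lo hi st; rewrite rhoD //.
  move: (fhat _ _ _ _) (fhat _ _ _ _) (F _ _ _) (_ / 2 * _) (f _) (f _).
  move=> ht H Ft E f0 f1 gap lo hi st E0.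
  (* The model predicts a decrease of at least half of [H - eps2 - fstar], and the serious step
     realizes the fraction [beta] of it. Bounding [H] by [f0 + eps2] makes the total error exactly
     [eps1 + eps2]. *)
  have : beta * ((H - eps2 - fstar) / 2) <= beta * (H - Ft).
    by apply: ler_wpM2l; [exact: ltW|lra].
  have : 0 <= (1 - beta / 2) * (f0 + eps2 - H) by apply: mulr_ge0; lra.
  lra.
have outer_all k : outer k.
  elim: k => // k IHk j; rewrite ltnS leq_eqVlt => /predU1P[->|/IHk //].
  by have [N [TN _ _]] := step k IHk; rewrite -/(Tk k) TN ltry.
have [gap gapE] : exists gap : nat -> R, forall k, gap k = f (x k 0%N) - fstar.
  by exists (fun k => f (x k 0%N) - fstar).
pose q := 1 - beta / 4.
have delta0 : 0 < deltaI by rewrite /deltaI divr_gt0 // mulr_gt0.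
(* Above the target accuracy the error eats at most half of the contraction [beta / 2], which leaves
   the factor [q]. *)
have eps_le k : deltaI < gap k -> eps1 + eps2 <= beta / 4 * gap k.
  rewrite /deltaI ltr_pdivrMr // /epsbar; nra.
have contract k : deltaI < gap k -> gap k.+1 <= q * gap k.
  move=> dk; have [N [_ _]] := step k (outer_all k).
  rewrite -!gapE; have := eps_le k dk; rewrite /q; lra.
have q01 : 0 < q < 1 by rewrite /q; lra.
have [q0 q1] := andP q01.
split.
- rewrite -gapE; pose K := max_outer beta deltaI (gap 0%N).
  have K0 : 0 <= K by exact: max_outer_ge0.
  (* If all iterates up to [K] were inaccurate, all these steps would contract, making the gap at
     [K] at most [deltaI]. *)
  apply: contrapT => none.
  have far k : (k%:Z <= K) -> deltaI < gap k.
    move=> kK; rewrite ltNge; apply/negP => dk; apply: none; exists k.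
    by rewrite -gapE.
  have geo k : k%:Z <= K -> gap k <= q ^+ k * gap 0%N.
    elim: k => [_|k IHk kK]; first by rewrite expr0 mul1r.
    have kK' : k%:Z <= K by apply: le_trans kK; rewrite lez_nat.
    apply: (le_trans (contract k (far k kK'))).
    by rewrite exprS -mulrA ler_wpM2l ?IHk // ltW.
  have KE : `|K|%N%:Z = K by rewrite gez0_abs.
  have gap0 : 0 < gap 0%N by apply: lt_trans delta0 (far _ _).
  have := max_outerP b01 delta0 gap0; rewrite -/K -/q.
  have := geo `|K|%N; have := far `|K|%N.
  rewrite KE lexx => /(_ isT) lt /(_ isT) le1.
  by move=> /(le_trans le1); rewrite leNgt lt.
- move=> k _ _ close.
  have {close} far j : (j < k)%N -> deltaI < gap j.
    by move=> /close; rewrite gapE.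
  (* The factor [16 / 9] is the squared inverse of the [3 / 4] in [lo]. *)
  pose C := 16 * 16 / 9 * G ^+ 2 * D ^+ 2 / (1 - beta) ^+ 2.
  have b2 : 0 < (1 - beta) ^+ 2 by rewrite exprn_gt0 // subr_gt0.
  have C0 : 0 <= C by rewrite divr_ge0 ?ltW // !mulr_gt0 // exprn_gt0.
  have gapj j : (j < k)%N -> 0 < gap j by move=> /far; apply: lt_trans.
  have Tj j : (j < k)%N -> (Tk j <= (C / gap j ^+ 2)%:E)%E.
    move=> jk; have [N [-> N_le _]] := step j (outer_all j).
    rewrite lee_fin (le_trans N_le) //.
    have gj := gapj j jk; have rj := rho0 j (outer_all j).
    (* The estimates lose at most [eps1 + eps2], hence at most [beta / 4 < 1 / 4] of the gap. *)
    have lo : 3 / 4 * gap j <= rho j * D ^+ 2.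
      have [+ _] := fhat_est j _ (outer_all j) (Xx j (outer_all j)).
      rewrite rhoD //.
      have := eps_le j (far j jk); rewrite gapE in gj *.
      have : 0 < (1 - beta) * (f (x j 0%N) - fstar).
        by rewrite mulr_gt0 // subr_gt0.
      lra.
    have -> : 16 * G ^+ 2 / ((1 - beta) ^+ 2 * rho j ^+ 2 * D ^+ 2)
        = 16 * G ^+ 2 * D ^+ 2 / (1 - beta) ^+ 2 / (rho j * D ^+ 2) ^+ 2.
      by field; rewrite !lt0r_neq0 // subr_gt0.
    have -> : C / gap j ^+ 2
        = 16 * G ^+ 2 * D ^+ 2 / (1 - beta) ^+ 2 / (3 / 4 * gap j) ^+ 2.
      by rewrite /C; field; rewrite !lt0r_neq0 // subr_gt0.
    rewrite ler_wpM2l //.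
      by rewrite divr_ge0 ?ltW // !mulr_gt0 // exprn_gt0.
    rewrite lef_pV2 ?posrE ?exprn_gt0 ?mulr_gt0 //.
    by rewrite lerXn2r ?nnegrE ?mulr_ge0 // ltW.
  apply: (@le_trans _ _ (\sum_(j < k) (C / gap j ^+ 2)%:E)%E).
    by apply: lee_sum => j _; exact: Tj.
  rewrite sumEFin lee_fin -mulr_sumr.
  have max0 : 0 <= max_inner beta G D epsbar. exact: max_inner_ge0.
  (* Without outer iterations the sum is empty; otherwise the new [k] is the last inaccurate one,
     and its gap still exceeds [deltaI]. *)
  case: k far gapj {Tj} => [_ _|k far gapj]; first by rewrite big_ord0 mulr0.
  have sum_le :
      \sum_(j < k.+1) (gap j ^+ 2)^-1 <= (gap k ^+ 2)^-1 / (1 - q ^+ 2).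
    apply: (@geometric_sum_le _ (fun j => (gap j ^+ 2)^-1)).
    + by rewrite sqr_ge0 exprn_ilt1 // ltW.
    + by move=> j _; rewrite invr_ge0 sqr_ge0.
    + move=> j jk; have gj := gapj j (leqW jk); have gSj := gapj j.+1 jk.
      have ctr := contract j (far j (leqW jk)).
      have : gap j.+1 ^+ 2 <= (q * gap j) ^+ 2.
        by rewrite lerXn2r ?nnegrE ?mulr_ge0 // ltW.
      rewrite exprMn => {}ctr; have gj2 : 0 < gap j ^+ 2 by rewrite exprn_gt0.
      have gSj2 : 0 < gap j.+1 ^+ 2 by rewrite exprn_gt0.
      by rewrite ler_pdivlMr // mulrC ler_pdivrMr.
  have q2 : 0 < 1 - q ^+ 2 by rewrite subr_gt0 exprn_ilt1 // ltW.
  have {}sum_le :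
      \sum_(j < k.+1) (gap j ^+ 2)^-1 <= (deltaI ^+ 2)^-1 / (1 - q ^+ 2).
    apply: (le_trans sum_le); rewrite ler_pM2r ?invr_gt0 //.
    have gk := gapj k (leqnn _); rewrite lef_pV2 ?posrE ?exprn_gt0 //.
    by rewrite lerXn2r ?nnegrE ?ltW // far.
  apply: (le_trans (ler_wpM2l C0 sum_le)).
  (* The series gives the claimed bound with a spare factor [2 * beta / 3], which is below 1. *)
  have -> : C * ((deltaI ^+ 2)^-1 / (1 - q ^+ 2)) =
      2 * beta / 3 * max_inner beta G D epsbar.
    have -> : 1 - q ^+ 2 = beta / 4 * (2 - beta / 4) by rewrite /q; field.
    rewrite /C /deltaI /max_inner; field.
    by rewrite !lt0r_neq0 ?subr_gt0 //; lra.
  by rewrite ler_piMl //; lra.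
(* The bound is an exact multiple of [(e ^+ 2)^-1]; the added 1 makes the constant positive. *)
- apply/eqO_exP; exists (`|max_inner beta G D 1| + 1).
    by rewrite ltr_wpDl.
  near=> e.
  have -> : max_inner beta G D e = max_inner beta G D 1 * (e ^+ 2)^-1.
    by rewrite /max_inner expr1n mulr1 invfM mulrA.
  rewrite normrM ler_wpM2r // lerDl //.
Unshelve. all: by end_near.
Qed.
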